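(* Let $X=\{0,1,\ldots,K\}$ and for $x\in X^n$ let $p_k(x)=|\{i:x_i=k\}|/n$. The function family $f_n(x_1,\ldots,x_n)=(p_0(x),p_1(x),\ldots,p_K(x))$ is computable with infinite memory.
   Context: Model. A network is a triple $(n,G,\mathcal L)$: $G$ is a connected undirected graph without self-arcs on $n\ge2$ nodes $\{1,\ldots,n\}$; $d(i)$ is the degree of node $i$; the port labeling $\mathcal L$ assigns to the edges at each node $i$ distinct port numbers in $\{0,1,\ldots,d(i)\}$. An algorithm is a family of deterministic automata $(A_d)_{d=1,2,\ldots}$, where $A_d$ is a map from $X\times Z_d\times(Y\cup\{\emptyset\})\times M^d$ into itself not changing the $X$-component. Here $Z_d$ is the internal memory set (containing a default symbol $\emptyset$), $Y$ is the output set, and $M$ is a finite message set (containing $\emptyset$); none of these depend on $n$. Node $i$ starts with initial value $x_i\in X$, with memory $z_i(0)$, output $y_i(0)$ and all outgoing messages equal to $\emptyset$. Let $j_1,\ldots,j_{d(i)}$ be the neighbors of $i$ in the order of the port numbers at $i$, and let $p_k$ be the index, in the corresponding enumeration at node $j_k$, of the edge from $j_k$ to $i$. At each time step every node $i$ updates synchronously $$[x_i,z_i(t+1),y_i(t+1);m_{i,1}(t+1),\ldots,m_{i,d(i)}(t+1)]=A_{d(i)}[x_i,z_i(t),y_i(t);m_{j_1,p_1}(t),\ldots,m_{j_{d(i)},p_{d(i)}}(t)].$$ The algorithm terminates with final output $y^*\in Y$ if there is a time $t'$ with $y_i(t)=y^*$ for all $i$ and all $t\ge t'$. A family of functions $f_n:X^n\to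 Y$ is computable with infinite memory if, with the sets $Z_d$ and $Y$ allowed to be countably infinite ($M$ finite), there is a family $(A_d)$ such that for every $n$, every network with $n$ nodes, and all initial values $x_1,\ldots,x_n$, the algorithm terminates with final output $f_n(x_1,\ldots,x_n)$. *)

(* Defs.v *)
From mathcomp Require Import all_boot all_order all_algebra.

Set Implicit Arguments.
Unset Strict Implicit.
Unset Printing Implicit Defensive.

(* The values of [port i] outside the neighbourhood of [i] are irrelevant.    *)
Record network (n : nat) := Network {
  adj : rel 'I_n;
  port : forall i : 'I_n, 'I_n -> 'I_(#|adj i|.+1);
  net_size : 1 < n;
  adj_sym : symmetric adj;
  adj_irr : irreflexive adj;
  adj_connected : forall i j, connect adj i j;
  port_inj : forall i, {in adj i &, injective (port i)}
}.

Section Ports.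
Variables (n : nat) (N : network n).
Implicit Types i j : 'I_n.

Definition deg i := #|adj N i|.

Definition nbrs i : seq 'I_n :=
  sort (fun j k => port N i j <= port N i k) (enum (adj N i)).

Lemma size_nbrs i : size (nbrs i) = deg i.
Proof. by rewrite size_sort -cardE. Qed.

Lemma mem_nbrs i j : (j \in nbrs i) = adj N i j.
Proof. by rewrite mem_sort mem_enum. Qed.

(* The neighbour j_(k+1) of [i]; since [k < deg i], the default is not used.  *)
Definition nbr i (k : 'I_(deg i)) : 'I_n := nth i (nbrs i) k.

Lemma adj_nbr i (k : 'I_(deg i)) : adj N i (nbr k).
Proof. by rewrite -mem_nbrs mem_nth // size_nbrs. Qed.

Lemma back_port_subproof i (k : 'I_(deg i)) :
  index i (nbrs (nbr k)) < deg (nbr k).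
Proof. by rewrite -size_nbrs index_mem mem_nbrs adj_sym adj_nbr. Qed.

(* The position p_(k+1) of the edge to [i] in the enumeration at [nbr k].     *)
Definition back_port i (k : 'I_(deg i)) : 'I_(deg (nbr k)) :=
  Ordinal (back_port_subproof k).

End Ports.

(* [None : option Y] is the default output.  Memory sets and the output set   *)
(* are countable, possibly infinite; the message set is finite.  The          *)
(* component [d = 0] is never run: every node of a network has degree >= 1.   *)
Record algorithm (X : Type) (Y : countType) := Algorithm {
  mem_set : nat -> countType;
  mem0 : forall d, mem_set d;
  msg_set : finType;
  msg0 : msg_set;
  automaton : forall d,
    X * mem_set d * option Y * {ffun 'I_d -> msg_set} ->
    X * mem_set d * option Y * {ffun 'I_d -> msg_set};
  automaton_input : forall d x z y m,
    (automaton (x, z, y, m) : X * mem_set d * option Y * _).1.1.1 = x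
}.

Section Execution.
Variables (X : Type) (Y : countType) (A : algorithm X Y).
Variables (n : nat) (N : network n).

(* Input, memory, output and outgoing messages of node [i].                   *)
Definition node_state (i : 'I_n) : Type :=
  X * mem_set A (deg N i) * option Y * {ffun 'I_(deg N i) -> msg_set A}.

Definition config : Type := forall i : 'I_n, node_state i.

Definition init (x : {ffun 'I_n -> X}) : config :=
  fun i => (x i, mem0 A (deg N i), None, [ffun=> msg0 A]).

Definition incoming (c : config) (i : 'I_n) :
    {ffun 'I_(deg N i) -> msg_set A} :=
  [ffun k => (c (nbr k)).2 (back_port k)].

Definition next (c : config) : config :=
  fun i => automaton ((c i).1, incoming c i).

Definition exec (x : {ffun 'I_n -> X}) (t : nat) : config :=
  iter t next (init x).

Definition output (c : config) (i : 'I_n) : option Y := (c i).1.2.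

Definition terminates_with (x : {ffun 'I_n -> X}) (ystar : Y) : Prop :=
  exists t', forall i t, t' <= t -> output (exec x t) i = Some ystar.

End Execution.

Definition computable_with_infinite_memory (X : Type) (Y : countType)
    (f : forall n, {ffun 'I_n -> X} -> Y) : Prop :=
  exists A : algorithm X Y,
    forall (n : nat) (N : network n) (x : {ffun 'I_n -> X}),
      terminates_with A N x (f n x).

Definition proportions (K n : nat) (x : {ffun 'I_n -> 'I_K.+1}) :
    {ffun 'I_K.+1 -> rat} :=
  [ffun k => (#|[set i | x i == k]|%:R / n%:R)%R].

(* Main.v *)
(* The view of a node is the tree of labelled walks issued from it, that is,  *)
(* the map sending a sequence of ports to the input found at the end of the   *)
(* corresponding walk.  One entry of one's own view is one entry of a         *)
(* neighbour's view, for a shorter walk; so if all nodes broadcast the        *)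
(* entries of their views in a fixed order, every node learns its whole view  *)
(* in the limit while using finitely many messages.  Nodes with equal views,  *)
(* even in different networks, see the same proportions: the number of        *)
(* neighbours with view [w] of a node with view [v] depends only on [v] and   *)
(* [w], and counting the arcs between the two classes from both ends shows    *)
(* that these numbers determine the ratios of the class sizes.  Networks are  *)
(* countably many, so a node outputs the proportions of the first network (in *)
(* a fixed enumeration) having a node which agrees with what the node knows   *)
(* of its own view; wrong candidates are eventually refuted.                  *)
Require Import Defs.
From mathcomp Require Import all_boot all_order all_algebra.
From mathcomp Require Import boolp.

Set Implicit Arguments.
Unset Strict Implicit.
Unset Printing Implicit Defensive.

(** Three facts carry the proof. [card_eq_view]: equal views force equal input frequencies.
    [exec_view_algorithm]: by time [t] a node knows the entries of its view of code at most [t].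
    [first_guess_converges]: guesses settle on a candidate that is never refuted. Its whole view is
    then that of the node ([consistent_view]), so its proportions are right even if it is not the
    actual network. *)

Section View.
Variables (X : eqType) (V : finType) (nb : V -> seq V) (x : V -> X).
Implicit Types (i j : V) (v w : seq nat -> option X).

(* The letters of a walk are shifted by one, [0] asking for the input of the  *)
(* current vertex: the empty walk, whose code is [0], then gets the value     *)
(* [None], which is the message imposed at time [0].  Degrees can be read off *)
(* a view, as [view i [:: k.+1; 0]] is [None] exactly if [size (nb i) <= k].  *)
Fixpoint view i (p : seq nat) : option X :=
  match p with
  | [::] => None
  | 0 :: _ => Some (x i)
  | k.+1 :: q => obind (fun j => view j q) (onth (nb i) k)
  end.

Definition undirected :=
  [forall i, forall j, count_mem j (nb i) == count_mem i (nb j)].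

Definition connected :=
  [forall i, forall j, connect (fun i j => j \in nb i) i j].

Definition class_size v := #|[pred i | view i == v]|.

Definition view_degree i w := count_mem w (map view (nb i)).

Lemma sum_view_degree i w :
  \sum_(j | view j == w) count_mem j (nb i) = view_degree i w.
Proof.
rewrite /view_degree count_map.
elim: (nb i) => [|a s IHs] /=; first by rewrite big1.
rewrite big_split /= IHs; congr (_ + _).
case: (boolP (view a == w)) => wa.
  rewrite (bigD1 a) //= eqxx big1 ?addn0 // => j /andP[_ /negPf].
  by rewrite eq_sym => ->.
by rewrite big1 // => j jw; case: eqP => // aj; rewrite aj jw in wa.
Qed.

End View.

(** Entries whose walks start with [k.+1] form the view of neighbour [k]; the walk [[:: k.+1; 0]]
    tells whether that neighbour exists. *)
Lemma eq_view_nbrs (X : eqType) (V1 V2 : finType)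
    (nb1 : V1 -> seq V1) (x1 : V1 -> X)
    (nb2 : V2 -> seq V2) (x2 : V2 -> X) i j :
  view nb1 x1 i = view nb2 x2 j ->
  map (view nb1 x1) (nb1 i) = map (view nb2 x2) (nb2 j).
Proof.
move=> eq_ij; apply: eq_from_onth => k; rewrite !onth_map.
have eq_k q : obind (fun a => view nb1 x1 a q) (onth (nb1 i) k) =
    obind (fun b => view nb2 x2 b q) (onth (nb2 j) k).
  by have /= := congr1 (fun v => v (k.+1 :: q)) eq_ij.
case: (onth (nb1 i) k) eq_k => [a|]; case: (onth (nb2 j) k) => [b|] //= eq_k.
- exact/congr1/funext.
- by have := eq_k [:: 0].
- by have := eq_k [:: 0].
Qed.

(** * Double counting between view classes *)

Section ViewClasses.
Variables (X : eqType) (V : finType) (nb : V -> seq V) (x : V -> X).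

Local Notation view := (view nb x).

(** Both sides count the arcs between the two classes: by [eq_view_nbrs] the view degree is constant
    on a class. *)
Lemma class_size_degree i j : undirected nb ->
  class_size nb x (view i) * view_degree nb x i (view j) =
  class_size nb x (view j) * view_degree nb x j (view i).
Proof.
move=> /forallP sym.
have expand a b : class_size nb x (view a) * view_degree nb x a (view b) =
    \sum_(i' | view i' == view a)
      \sum_(j' | view j' == view b) count_mem j' (nb i').
  rewrite -sum_nat_const; apply: eq_bigr => i' /eqP eq_i'.
  by rewrite sum_view_degree /view_degree (eq_view_nbrs eq_i').
rewrite !expand exchange_big /=; apply: eq_bigr => i' _; apply: eq_bigr => j' _.
by apply/eqP/(forallP (sym _)).
Qed.

Lemma view_degree_gt0 i j : j \in nb i -> 0 < view_degree nb x i (view j).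
Proof.
move=> ij; rewrite -has_count; apply/hasP.
by exists (view j) => /=; rewrite ?map_f.
Qed.

Lemma class_size_gt0 i : 0 < class_size nb x (view i).
Proof. by apply/card_gt0P; exists i; rewrite inE. Qed.

Lemma card_view_classes (s : seq (seq nat -> option X))
    (P : pred (seq nat -> option X)) :
  uniq s -> (forall i, view i \in s) ->
  #|[pred i | P (view i)]| = \sum_(v <- s | P v) class_size nb x v.
Proof.
move=> s_uniq s_views.
under eq_bigr do rewrite /class_size -sum1_card.
rewrite (exchange_big_dep (fun i => P (view i))) /=; last first.
  by move=> v i Pv; rewrite inE => /eqP ->.
rewrite -sum1_card; apply: eq_bigr => i; rewrite inE => Pi.
rewrite (eq_bigl (pred1 (view i))) => [|v /=]; last first.
  by rewrite inE eq_sym andb_idl // => /eqP ->.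
by rewrite -big_filter filter_pred1_uniq // big_seq1.
Qed.

End ViewClasses.

Lemma in_nbC (V : finType) (nb : V -> seq V) i j :
  undirected nb -> (j \in nb i) = (i \in nb j).
Proof.
move=> /forallP/(_ i)/forallP/(_ j)/eqP sym.
by rewrite -!has_pred1 !has_count sym.
Qed.

Section SameView.
Variables (X : eqType) (V1 V2 : finType).
Variables (nb1 : V1 -> seq V1) (x1 : V1 -> X).
Variables (nb2 : V2 -> seq V2) (x2 : V2 -> X).
Hypotheses (undir1 : undirected nb1) (undir2 : undirected nb2).
Hypothesis (conn1 : connected nb1).
Variables (i0 : V1) (j0 : V2).
Hypothesis same_view : view nb1 x1 i0 = view nb2 x2 j0.

Let v0 := view nb1 x1 i0.

(** Induction along a path from [i0]: equal views yield a matching neighbour, and the arc counts of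
    both networks involve the same view degrees. The one into the previous class is positive and
    cancels. *)
Lemma class_size_ratio i :
  (exists j, view nb2 x2 j = view nb1 x1 i) /\
  class_size nb2 x2 (view nb1 x1 i) * class_size nb1 x1 v0 =
  class_size nb1 x1 (view nb1 x1 i) * class_size nb2 x2 v0.
Proof.
have /forallP/(_ i0)/forallP/(_ i)/connectP[p path_p ->] := conn1.
elim/last_ind: p path_p => [|p i' IHp] /=.
  by move=> _; split; [exists j0 | rewrite mulnC].
rewrite rcons_path last_rcons => /andP[/IHp{IHp} [[j eq_j] ratio] arc].
set i1 := last i0 p in eq_j ratio arc.
have := map_f (view nb1 x1) arc.
rewrite -(eq_view_nbrs eq_j) => /mapP[j' _ eq_j'].
split; first by exists j'.
have := class_size_degree x1 i1 i' undir1.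
have := class_size_degree x2 j j' undir2.
rewrite -eq_j' eq_j /view_degree (eq_view_nbrs eq_j).
rewrite (eq_view_nbrs (esym eq_j')).
rewrite -!/(view_degree _ _ _ _) => deg2 deg1.
have d'_gt0 : 0 < view_degree nb1 x1 i' (view nb1 x1 i1).
  by apply: view_degree_gt0; rewrite in_nbC.
apply/eqP; rewrite -(eqn_pmul2r d'_gt0); apply/eqP.
by rewrite mulnAC -deg2 mulnAC ratio mulnAC deg1 mulnAC.
Qed.

End SameView.

Lemma card_eq_view (X : eqType) (V1 V2 : finType)
    (nb1 : V1 -> seq V1) (x1 : V1 -> X)
    (nb2 : V2 -> seq V2) (x2 : V2 -> X) i0 j0 k :
  undirected nb1 -> connected nb1 -> undirected nb2 -> connected nb2 ->
  view nb1 x1 i0 = view nb2 x2 j0 ->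
  #|[pred i | x1 i == k]| * #|V2| = #|[pred j | x2 j == k]| * #|V1|.
Proof.
move=> undir1 conn1 undir2 conn2 eq0.
pose s := undup (map (view nb1 x1) (enum V1)).
have s_views1 i : view nb1 x1 i \in s by rewrite mem_undup map_f ?mem_enum.
have s_views2 j : view nb2 x2 j \in s.
  by have [[i <-] _] := class_size_ratio undir2 undir1 conn2 (esym eq0) j.
have s_uniq : uniq s := undup_uniq _.
pose v0 := view nb1 x1 i0.
have ratio (P : pred (seq nat -> option X)) :
    #|[pred j | P (view nb2 x2 j)]| * class_size nb1 x1 v0 =
    #|[pred i | P (view nb1 x1 i)]| * class_size nb2 x2 v0.
  rewrite (card_view_classes _ s_uniq s_views1).
  rewrite (card_view_classes _ s_uniq s_views2).
  rewrite !big_distrl big_seq_cond [RHS]big_seq_cond; apply: eq_bigr => v /=.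
  rewrite mem_undup => /andP[/mapP[i _ ->] _].
  by have [] := class_size_ratio undir1 undir2 conn1 eq0 i.
(* The walk [[:: 0]] reads the input; [predT] gives the total sizes. The common ratio of class sizes
   is then eliminated. *)
have := ratio (fun v => v [:: 0] == Some k); have := ratio predT.
have -> : #|[pred j | predT (view nb2 x2 j)]| = #|V2| by apply: eq_card.
have -> : #|[pred i | predT (view nb1 x1 i)]| = #|V1| by apply: eq_card.
rewrite /=.
have -> : #|[pred j | Some (x2 j) == Some k]| = #|[pred j | x2 j == k]|.
  by apply: eq_card.
have -> : #|[pred i | Some (x1 i) == Some k]| = #|[pred i | x1 i == k]|.
  by apply: eq_card.
have a_gt0 : 0 < class_size nb1 x1 v0 := class_size_gt0 _ _ _.
have b_gt0 : 0 < class_size nb2 x2 v0 by rewrite /v0 eq0 class_size_gt0.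
move=> ratioT ratiok.
apply/eqP; rewrite -(eqn_pmul2r a_gt0) -(eqn_pmul2r b_gt0); apply/eqP.
by rewrite -mulnA [_ v0 * _]mulnC mulnACA -ratiok ratioT mulnACA mulnA.
Qed.

(** * Identification in the limit *)

Section LimitGuess.
Variables (T : countType) (P : nat -> pred T).

Definition first_guess t :=
  ohead [seq c <- pmap unpickle (iota 0 t) | P t c].

Hypothesis P_antitone : forall t t' c, t <= t' -> P t' c -> P t c.

Lemma first_guess_converges c0 : (forall t, P t c0) ->
  exists c, (forall t, P t c) /\
    exists t0, forall t, t0 <= t -> first_guess t = Some c.
Proof.
move=> P_c0.
pose good q := `[<exists c, unpickle q = Some c /\ forall t, P t c>].
have [|q /asboolP[c [q_c P_c]] q_min] := @ex_minnP good.
  by exists (pickle c0); apply/asboolP; exists c0; rewrite pickleK.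
exists c; split=> //.
(* By minimality of [q], each of the finitely many smaller codes is refuted at some time, and stays
   so by antitonicity. *)
have [t1 empty] : exists t1, forall t, t1 <= t ->
    [seq c <- pmap unpickle (iota 0 q) | P t c] = [::].
  elim: {-2}q (leqnn q) => [|r IHr] lt_rq; first by exists 0.
  have [t1 t1P] := IHr (ltnW lt_rq).
  have [t2 t2P] : exists t2, forall t, t2 <= t ->
      forall c', unpickle r = Some c' -> ~~ P t c'.
    case r_c': (unpickle r) => [c'|]; last by exists 0.
    have /existsNP[t2 /negP notP] : ~ forall t, P t c'.
      move=> P_c'; move: lt_rq; rewrite ltnNge q_min //.
      by apply/asboolP; exists c'.
    by exists t2 => t le_t2 _ [<-]; apply: contra notP; apply: P_antitone.
  exists (maxn t1 t2) => t; rewrite geq_max => /andP[le1 le2].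
  rewrite -addn1 iotaD pmap_cat filter_cat t1P // add0n /=.
  by case r_c': unpickle => [c'|] //=; rewrite (negPf (t2P t le2 c' r_c')).
exists (maxn t1 q.+1) => t; rewrite geq_max => /andP[le_t1 lt_qt].
have split_iota : iota 0 t = iota 0 q ++ q :: iota q.+1 (t - q.+1).
  by rewrite -{1}(subnKC lt_qt) addSnnS iotaD.
by rewrite /first_guess split_iota pmap_cat filter_cat empty //= q_c /= P_c.
Qed.

End LimitGuess.

(** * The broadcast protocol *)

Lemma code_behead k q : CodeSeq.code q < CodeSeq.code (k :: q).
Proof.
rewrite /= -[X in X < _]mul1n; apply: (@leq_trans (1 * (CodeSeq.code q).*2.+1)).
  by rewrite !mul1n ltnS -addnn leq_addr.
by rewrite leq_mul // expn_gt0.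
Qed.

Section Protocol.
Variable X : finType.

(* The part of its own view that a node of degree [d] and input [x] computes  *)
(* from the list [h] of the messages it has received, [h] listing at position *)
(* [s] the entries of code [s] of the views of its neighbours; [None] is also *)
(* returned for the entries which are still unknown.                          *)
Definition local_view d (x : X) (h : seq {ffun 'I_d -> option X})
    (p : seq nat) : option X :=
  match p with
  | [::] => None
  | 0 :: _ => Some x
  | k.+1 :: q =>
    obind (fun k' : 'I_d => nth [ffun=> None] h (CodeSeq.code q) k') (insub k)
  end.

(** Bare neighbour lists with inputs and a root make the type countable; graph conditions are tested
    in [consistent]. *)
Definition candidate : countType :=
  {n : nat & ({ffun 'I_n -> seq 'I_n} * {ffun 'I_n -> X} * 'I_n)%type}.

Definition candidate_view (c : candidate) :=
  view (tagged c).1.1 (tagged c).1.2 (tagged c).2.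

Definition consistent (v : seq nat -> option X) t (c : candidate) :=
  [&& undirected (tagged c).1.1, connected (tagged c).1.1
    & all (fun s => candidate_view c (CodeSeq.decode s) == v (CodeSeq.decode s))
        (iota 0 t)].

Lemma consistent_antitone v t t' (c : candidate) :
  t <= t' -> consistent v t' c -> consistent v t c.
Proof.
move=> le_t /and3P[undir conn /allP agree]; apply/and3P; split=> //.
apply/allP => s; rewrite mem_iota => /= lt_s; apply: agree.
by rewrite mem_iota; apply: leq_trans le_t.
Qed.

Lemma consistent_candidate_view (c : candidate) t :
  undirected (tagged c).1.1 -> connected (tagged c).1.1 ->
  consistent (candidate_view c) t c.
Proof. by move=> undir conn; apply/and3P; split=> //; apply/allP => s _ /=. Qed.

Lemma consistent_view v (c : candidate) :
  (forall t, consistent v t c) -> candidate_view c = v.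
Proof.
move=> c_consistent; apply/funext => p.
have /and3P[_ _ /allP agree] := c_consistent (CodeSeq.code p).+1.
have := agree (CodeSeq.code p).
by rewrite mem_iota /= ltnSn CodeSeq.codeK => /(_ isT)/eqP.
Qed.

Variables (Y : countType) (f : forall n, {ffun 'I_n -> X} -> Y).

Definition guess (v : seq nat -> option X) t : option Y :=
  omap (fun c : candidate => f (tagged c).1.2) (first_guess (consistent v) t).

Lemma eq_guess v w t :
  (forall s, s < t -> v (CodeSeq.decode s) = w (CodeSeq.decode s)) ->
  guess v t = guess w t.
Proof.
move=> eq_vw; rewrite /guess /first_guess; congr (omap _ (ohead _)).
apply: eq_filter => c; rewrite /consistent; congr [&& _, _ & _].
by apply: eq_in_all => s; rewrite mem_iota => /eq_vw ->.
Qed.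

Definition broadcast_step d
    (s : X * seq {ffun 'I_d -> option X} * option Y *
         {ffun 'I_d -> option X}) :=
  let: (x, h, _, m) := s in
  let h' := rcons h m in
  let v := local_view x h' in
  (x, h', guess v (size h'), [ffun _ : 'I_d => v (CodeSeq.decode (size h'))]).

Lemma broadcast_step_input d x z y m :
  (@broadcast_step d (x, z, y, m)).1.1.1 = x.
Proof. by []. Qed.

Definition view_algorithm : algorithm X Y :=
  @Algorithm X Y (fun d => seq {ffun 'I_d -> option X} : countType) (fun=> [::])
    (option X : finType) None broadcast_step broadcast_step_input.

Section Run.
Variables (n : nat) (N : network n) (x : {ffun 'I_n -> X}).

Local Notation network_view := (view (nbrs N) x).

Definition history i t : seq {ffun 'I_(deg N i) -> option X} :=
  mkseq (fun s => [ffun k => network_view (nbr k) (CodeSeq.decode s)]) t.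

Lemma local_view_history i t p : CodeSeq.code p <= t ->
  local_view (x i) (history i t) p = network_view i p.
Proof.
case: p => [|[|k] q] //= code_p.
case: insubP => [k' _ <-|] /=; last first.
  by rewrite -leqNgt -size_nbrs => /onth_default ->.
(* The tail of a walk has a smaller code, so the neighbour has already sent that entry. *)
rewrite nth_mkseq ?ffunE; last exact: leq_trans (code_behead k.+1 q) code_p.
have : k' < size (nbrs N i) by rewrite size_nbrs.
rewrite -onthTE /nbr; case onth_k: onth => [j|] //= _.
by rewrite (onth_nth i _ _ _ onth_k) CodeSeq.codeK.
Qed.

Lemma exec_view_algorithm t i :
  exec view_algorithm N x t i =
  (x i, history i t, if t is 0 then None else guess (network_view i) t,
   [ffun=> network_view i (CodeSeq.decode t)]).
Proof.
elim: t i => [|t IHt] i; first by [].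
have local p : CodeSeq.code p <= t.+1 ->
    local_view (x i) (history i t.+1) p = network_view i p.
  exact: local_view_history.
rewrite /exec iterS -/(exec _ _ _ _) /Defs.next.
have -> : incoming (exec view_algorithm N x t) i =
    [ffun k => network_view (nbr k) (CodeSeq.decode t)].
  by apply/ffunP => k; rewrite !ffunE IHt ffunE.
rewrite IHt /= -mkseqS -/(history i t.+1) size_mkseq local ?CodeSeq.decodeK //.
congr (_, _, _); apply: eq_guess => s s_lt.
by rewrite local // CodeSeq.decodeK ltnW.
Qed.

End Run.
End Protocol.

(** * Application to networks *)

Lemma undirected_nbrs n (N : network n) : undirected (nbrs N).
Proof.
apply/forallP => i; apply/forallP => j.
by rewrite !count_uniq_mem ?sort_uniq ?enum_uniq // !mem_nbrs adj_sym.
Qed.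

Lemma connected_nbrs n (N : network n) : connected (nbrs N).
Proof.
apply/forallP => i; apply/forallP => j.
rewrite (eq_connect (e' := adj N)) ?adj_connected // => a b; exact: mem_nbrs.
Qed.

Lemma eq_view_proportions K m n
    (nb1 : 'I_m -> seq 'I_m) (nb2 : 'I_n -> seq 'I_n)
    (x : {ffun 'I_m -> 'I_K.+1}) (y : {ffun 'I_n -> 'I_K.+1}) i j :
  undirected nb1 -> connected nb1 -> undirected nb2 -> connected nb2 ->
  view nb1 x i = view nb2 y j -> proportions x = proportions y.
Proof.
move=> undir1 conn1 undir2 conn2 eq_ij; apply/ffunP => k; rewrite !ffunE.
have := card_eq_view k undir1 conn1 undir2 conn2 eq_ij.
have cardE n' (z : {ffun 'I_n' -> 'I_K.+1}) :
    #|[pred i | z i == k]| = #|[set i | z i == k]|.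
  by apply: eq_card => a; rewrite !inE.
rewrite !card_ord !cardE => eq_count; apply/eqP.
rewrite GRing.eqr_div ?Num.Theory.pnatr_eq0 -?lt0n.
- by rewrite -!GRing.natrM eq_count.
- exact: leq_ltn_trans (ltn_ord i).
- exact: leq_ltn_trans (ltn_ord j).
Qed.

Theorem theorem9p6 (K : nat) :
  @computable_with_infinite_memory 'I_K.+1 {ffun 'I_K.+1 -> rat}
    (fun n (x : {ffun 'I_n -> 'I_K.+1}) => proportions x).
Proof.
pose A := view_algorithm (fun n (x : {ffun 'I_n -> 'I_K.+1}) => proportions x).
exists A => n N x.
have limit i : exists t0, forall t, t0 <= t ->
    output (exec A N x t) i = Some (proportions x).
  pose c0 : candidate 'I_K.+1 := Tagged
    (fun n => ({ffun 'I_n -> seq 'I_n} * {ffun 'I_n -> 'I_K.+1} * 'I_n)%type)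
    (finfun (nbrs N), x, i).
  have c0_nbrs : (tagged c0).1.1 = nbrs N :> ('I_n -> seq 'I_n).
    by apply/funext => j; rewrite ffunE.
  have c0_consistent t : consistent (view (nbrs N) x i) t c0.
    rewrite -c0_nbrs; apply: consistent_candidate_view; rewrite c0_nbrs.
    - exact: undirected_nbrs.
    - exact: connected_nbrs.
  have [c [c_consistent [t0 c_limit]]] :=
    first_guess_converges (@consistent_antitone _ _) c0_consistent.
  (* Time [0] is excluded because the initial output is [None]. *)
  exists (maxn t0 1) => -[|t]; rewrite geq_max ?andbF // => /andP[le_t _].
  rewrite /output exec_view_algorithm /guess c_limit //=; congr Some.
  have /and3P[undir_c conn_c _] := c_consistent 0.
  exact: eq_view_proportions undir_c conn_c (undirected_nbrs N)
    (connected_nbrs N) (consistent_view c_consistent).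
have [t0 t0P] := choice limit.
exists (\max_i t0 i) => i t le_t.
by apply: t0P; apply: leq_trans le_t; apply: leq_bigmax.
Qed.
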